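(* Let $H=\mathbb{C}[\mathcal{A}_4]$ with the differential calculus defined by the conjugacy class $\mathcal{C}=\{t,x,y,z\}$, where $t=(123)$, $x=(134)$, $y=(243)$, $z=(142)$, and let $A_a=e_a-\frac14\theta$, $a\in\mathcal{C}$, be the Levi-Civita connection on $\mathcal{A}_4$. Its covariant derivative $\nabla:\Omega^1(H)\to\Omega^1(H)\otimes_H\Omega^1(H)$ and its Riemann curvature $\mathcal{R}:\Omega^1(H)\to\Omega^2(H)\otimes_H\Omega^1(H)$ are given by $$\begin{aligned} \nabla(e_t)&=-e_t\otimes_H e_t-e_x\otimes_H e_z-e_y\otimes_H e_x-e_z\otimes_H e_y+\tfrac14\theta\otimes_H\theta,\\ \nabla(e_x)&=-e_t\otimes_H e_y-e_x\otimes_H e_x-e_y\otimes_H e_z-e_z\otimes_H e_t+\tfrac14\theta\otimes_H\theta,\\ \nabla(e_y)&=-e_t\otimes_H e_z-e_x\otimes_H e_t-e_y\otimes_H e_y-e_z\otimes_H e_x+\tfrac14\theta\otimes_H\theta,\\ \nabla(e_z)&=-e_t\otimes_H e_x-e_x\otimes_H e_y-e_y\otimes_H e_t-e_z\otimes_H e_z+\tfrac14\theta\otimes_H\theta, \end{aligned}$$ $$\begin{aligned} \mathcal{R}(e_t)&=\mathrm{d}e_t\otimes_H e_t+\mathrm{d}e_x\otimes_H e_z+\mathrm{d}e_y\otimes_H e_x+\mathrm{d}e_z\otimes_H e_y,\\ \mathcal{R}(e_x)&=\mathrm{d}e_t\otimes_H e_y+\mathrm{d}e_x\otimes_H e_x+\mathrm{d}e_y\otimes_H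 e_z+\mathrm{d}e_z\otimes_H e_t,\\ \mathcal{R}(e_y)&=\mathrm{d}e_t\otimes_H e_z+\mathrm{d}e_x\otimes_H e_t+\mathrm{d}e_y\otimes_H e_y+\mathrm{d}e_z\otimes_H e_x,\\ \mathcal{R}(e_z)&=\mathrm{d}e_t\otimes_H e_x+\mathrm{d}e_x\otimes_H e_y+\mathrm{d}e_y\otimes_H e_t+\mathrm{d}e_z\otimes_H e_z. \end{aligned}$$
   Context: $\mathcal{A}_4$ is the alternating group of order 12; products of permutations are composed right to left. Differential calculus: $H=\mathbb{C}[\mathcal{A}_4]$ is the algebra of complex functions on $\mathcal{A}_4$, and $(R_af)(g)=f(ga)$. $\Omega^1(H)$ is the free left $H$-module with basis the Maurer-Cartan 1-forms $\{e_a\}_{a\in\mathcal{C}}$, with right module structure $e_af=R_a(f)e_a$, and $\mathrm{d}f=\sum_{a\in\mathcal{C}}(R_af-f)e_a$. Let $\Psi$ be the $H$-bimodule map on $\Omega^1(H)\otimes_H\Omega^1(H)$ with $\Psi(e_a\otimes_H e_b)=e_{aba^{-1}}\otimes_H e_a$. Then $\Omega^2(H)=(\Omega^1(H)\otimes_H\Omega^1(H))/\ker(\mathrm{id}-\Psi)$, with $\wedge$ the image in the quotient, and $\mathrm{d}e_a=\theta\wedge e_a+e_a\wedge\theta$, where $\theta=\sum_{a\in\mathcal{C}}e_a$; $\mathrm{d}$ is $\mathbb{C}$-linear on 1-forms with $\mathrm{d}(fe_a)=\mathrm{d}f\wedge e_a+f\,\mathrm{d}e_a$. For a connection $\{A_a\}_{a\in\mathcal{C}}$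 (a collection of 1-forms) and a 1-form $\alpha=\sum_a\alpha^ae_a$ with $\alpha^a\in H$, the covariant derivative is $$\nabla\alpha=\sum_a\mathrm{d}\alpha^a\otimes_H e_a-\sum_{a}\alpha^a\sum_{b\in\mathcal{C}}A_b\otimes_H(e_{b^{-1}ab}-e_a).$$ The curvature 2-forms of a regular connection are $$F_a=\mathrm{d}A_a+\sum_{c,d\in\mathcal{C},\,cd=a}A_c\wedge A_d-\sum_{c\in\mathcal{C}}(A_c\wedge A_a+A_a\wedge A_c),$$ and the Riemann curvature is $\mathcal{R}\alpha=\sum_a\alpha^a\sum_{b\in\mathcal{C}}F_b\otimes_H(e_{b^{-1}ab}-e_a)$. (Regular means $\sum_{a,b\in\mathcal{C};\,ab=g}A_a\wedge A_b=0$ for all $g\neq e$, $g\notin\mathcal{C}$, with $e$ the group identity.) *)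

(* Defs.v *)
From HB Require Import structures.
From mathcomp Require Import all_boot all_order all_algebra all_fingroup.
From mathcomp Require Import all_solvable ring_quotient complex reals.

Set Implicit Arguments.
Unset Strict Implicit.
Unset Printing Implicit Defensive.

Import GRing.Theory Num.Theory.
Local Open Scope ring_scope.

(* H = K[gT] is {ffun gT -> K} with its pointwise ring structure.
   The basis of 1-forms is indexed by the elements of C, so that a 1-form
   \sum_a alpha^a e_a is the family of its coefficients alpha^a. *)
Section Calculus.

Variables (K : fieldType) (gT : finGroupType) (C : {set gT}).

Local Notation H := {ffun gT -> K}.
Local Notation I := {a : gT | a \in C}.
Local Notation Omega1 := {ffun I -> H^o}.

Lemma HmulC (f g : H) : f * g = g * f.
Proof. exact: ffun_mulC. Qed.

Definition Rtrans (a : gT) (f : H) : H := [ffun g => f (g * a)%g].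

Definition cst (c : K) : H := [ffun => c].

(* The 1-form e_a. It is indexed by the whole group in order to write e_{aba^-1}
   for a, b in C; it vanishes for a outside C, which does not occur when C is
   stable under conjugation. *)
Definition mc (a : gT) : Omega1 := [ffun c : I => (val c == a)%:R : H].

Definition theta : Omega1 := \sum_(a : I) mc (val a).

(* (\sum_a alpha^a e_a) f = \sum_a alpha^a R_a(f) e_a *)
Definition rmul1 (alpha : Omega1) (f : H) : Omega1 :=
  [ffun a : I => (alpha a : H) * Rtrans (val a) f].

Definition d0 (f : H) : Omega1 :=
  \sum_(a : I) (Rtrans (val a) f - f) *: mc (val a).

(* M (x)_H Omega^1 for a right H-module M. As Omega^1 is free as a left module
   on the e_b, every element is uniquely \sum_b m_b (x) e_b, and it is
   represented by the family (m_b)_b; hence m (x) \sum_b f^b e_b is the family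
   (m f^b)_b. The lemmas tensor_balanced and tensor_universal below state that
   this is the tensor product over H; their hypotheses on the right action are
   proved for M = Omega^1 in rmul1Dl, rmul1Dr, rmul1A, rmul1_1, and for
   M = Omega^2 in rmul2Dl, rmul2Dr, rmul2A, rmul2_1. *)
Section Tensor.

Variables (M : zmodType) (act : M -> H -> M).

Definition tensor (m : M) (alpha : Omega1) : {ffun I -> M} :=
  [ffun b => act m (alpha b)].

Hypothesis actDl : forall f, {morph act^~ f : m n / m + n}.
Hypothesis actDr : forall m, {morph act m : f g / f + g}.
Hypothesis actA : forall m f g, act (act m f) g = act m (f * g).
Hypothesis act1 : forall m, act m 1 = m.

Lemma tensorDl alpha : {morph tensor^~ alpha : m n / m + n}.
Proof. by move=> m n; apply/ffunP => b; rewrite !ffunE actDl. Qed.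

Lemma tensorDr m : {morph tensor m : alpha beta / alpha + beta}.
Proof. by move=> x y; apply/ffunP => b; rewrite !ffunE actDr. Qed.

Lemma tensor_balanced m f alpha : tensor (act m f) alpha = tensor m (f *: alpha).
Proof. by apply/ffunP => b; rewrite !ffunE actA. Qed.

Lemma act_0 m : act m 0 = 0.
Proof. by apply: (addIr (act m 0)); rewrite -actDr !add0r. Qed.

Lemma mc_delta (b : I) : mc (val b) b = 1.
Proof. by rewrite ffunE eqxx. Qed.

Lemma tensor_decomp (w : {ffun I -> M}) : w = \sum_b tensor (w b) (mc (val b)).
Proof.
apply/ffunP => c; rewrite sum_ffunE (bigD1 c) //= big1 ?addr0.
  by rewrite ffunE mc_delta act1.
move=> b nbc; rewrite !ffunE (inj_eq val_inj) eq_sym (negPf nbc).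
exact: act_0.
Qed.

Lemma mc_decomp (alpha : Omega1) : alpha = \sum_b (alpha b : H) *: mc (val b).
Proof.
apply/ffunP => c; rewrite sum_ffunE (bigD1 c) //= big1 ?addr0.
  by rewrite ffunE mc_delta [_ *: _]mulr1.
move=> b nbc; rewrite !ffunE (inj_eq val_inj) eq_sym (negPf nbc).
exact: mulr0.
Qed.

Lemma tensor_universal (Z : zmodType) (phi : M -> Omega1 -> Z) :
    (forall alpha, {morph phi^~ alpha : m n / m + n}) ->
    (forall m, {morph phi m : alpha beta / alpha + beta}) ->
    (forall m f alpha, phi (act m f) alpha = phi m (f *: alpha)) ->
  exists2 Phi : {additive {ffun I -> M} -> Z},
    forall m alpha, Phi (tensor m alpha) = phi m alpha &
    forall Phi' : {additive {ffun I -> M} -> Z},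
      (forall m alpha, Phi' (tensor m alpha) = phi m alpha) -> Phi =1 Phi'.
Proof.
move=> phiDl phiDr phiB.
have phi0l a : phi 0 a = 0 by apply: (addIr (phi 0 a)); rewrite -phiDl !add0r.
have phi0r m : phi m 0 = 0 by apply: (addIr (phi m 0)); rewrite -phiDr !add0r.
pose F (w : {ffun I -> M}) := \sum_b phi (w b) (mc (val b)).
have Fzmod : zmod_morphism F.
  move=> u v; rewrite /F -sumrB; apply: eq_bigr => b _; rewrite !ffunE.
  by apply: (addIr (phi (v b) (mc (val b)))); rewrite -phiDl !subrK.
pose FM := GRing.isZmodMorphism.Build _ _ F Fzmod.
pose Fa : {additive {ffun I -> M} -> Z} := HB.pack F FM.
have FaE m alpha : Fa (tensor m alpha) = phi m alpha.
  rewrite {2}(mc_decomp alpha) /= /F.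
  rewrite (big_morph (phi m) (phiDr m) (phi0r m)).
  by apply: eq_bigr => b _; rewrite ffunE phiB.
exists Fa => // G GE w; rewrite [w]tensor_decomp !raddf_sum.
by apply: eq_bigr => b _; rewrite GE FaE.
Qed.

End Tensor.

Lemma rmul1Dl f : {morph rmul1^~ f : x y / x + y}.
Proof. by move=> x y; apply/ffunP => a; rewrite !ffunE mulrDl. Qed.

Lemma RtransD a : {morph Rtrans a : f g / f + g}.
Proof. by move=> f g; apply/ffunP => x; rewrite !ffunE. Qed.

Lemma RtransM a : {morph Rtrans a : f g / f * g}.
Proof. by move=> f g; apply/ffunP => x; rewrite !ffunE. Qed.

Lemma Rtrans1 a : Rtrans a 1 = 1.
Proof. by apply/ffunP => x; rewrite !ffunE. Qed.

Lemma Rtrans_comp a b f : Rtrans a (Rtrans b f) = Rtrans (a * b) f.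
Proof. by apply/ffunP => x; rewrite !ffunE mulgA. Qed.

Lemma rmul1Dr alpha : {morph rmul1 alpha : f g / f + g}.
Proof. by move=> f g; apply/ffunP => a; rewrite !ffunE RtransD mulrDr. Qed.

Lemma rmul1A alpha f g : rmul1 (rmul1 alpha f) g = rmul1 alpha (f * g).
Proof. by apply/ffunP => a; rewrite !ffunE RtransM mulrA. Qed.

Lemma rmul1_1 alpha : rmul1 alpha 1 = alpha.
Proof. by apply/ffunP => a; rewrite !ffunE Rtrans1 mulr1. Qed.

Lemma rmul1Z f alpha g : rmul1 (f *: alpha) g = f *: rmul1 alpha g.
Proof. by apply/ffunP => a; rewrite !ffunE [RHS]mulrA. Qed.

Lemma rmul1_mc a f : rmul1 (mc a) f = Rtrans a f *: mc a.
Proof.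
apply/ffunP => c; rewrite !ffunE [RHS]HmulC.
by case: eqP => [->//|_]; rewrite !mul0r.
Qed.

Local Notation Omega11 := {ffun I -> Omega1}.

Definition tensor11 (alpha beta : Omega1) : Omega11 := tensor rmul1 alpha beta.

(* (m (x) e_b) f = m R_b(f) (x) e_b *)
Definition rmul11 (w : Omega11) (f : H) : Omega11 :=
  [ffun b : I => rmul1 (w b) (Rtrans (val b) f)].

Lemma tensor11Z f alpha beta :
  tensor11 (f *: alpha) beta = f *: tensor11 alpha beta.
Proof. by apply/ffunP => b; rewrite !ffunE rmul1Z. Qed.

Lemma rmul11_tensor alpha beta f :
  rmul11 (tensor11 alpha beta) f = tensor11 alpha (rmul1 beta f).
Proof. by apply/ffunP => b; rewrite !ffunE rmul1A. Qed.

Lemma rmul11Dl f : {morph rmul11^~ f : x y / x + y}.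
Proof. by move=> x y; apply/ffunP => a; rewrite !ffunE rmul1Dl. Qed.

Lemma rmul11Dr w : {morph rmul11 w : f g / f + g}.
Proof. by move=> f g; apply/ffunP => a; rewrite !ffunE RtransD rmul1Dr. Qed.

Lemma rmul11A w f g : rmul11 (rmul11 w f) g = rmul11 w (f * g).
Proof. by apply/ffunP => a; rewrite !ffunE RtransM rmul1A. Qed.

Lemma rmul11_1 w : rmul11 w 1 = w.
Proof. by apply/ffunP => a; rewrite !ffunE Rtrans1 rmul1_1. Qed.

Lemma rmul11Z f w g : rmul11 (f *: w) g = f *: rmul11 w g.
Proof. by apply/ffunP => a; rewrite !ffunE rmul1Z. Qed.

(* The coefficient of e_a (x) e_b in w is w b a. That Psi is a map of bimodules
   with the prescribed values on the e_a (x) e_b is Psi_is_linear, Psi_rmul and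
   Psi_tensor. *)
Definition Psi (w : Omega11) : Omega11 :=
  \sum_(b : I) \sum_(a : I)
    (w b a : H) *: tensor11 (mc (val a * val b * (val a)^-1)%g) (mc (val a)).

Lemma Psi_is_linear : linear Psi.
Proof.
move=> f u v; rewrite /Psi scaler_sumr -big_split; apply: eq_bigr => b _ /=.
rewrite scaler_sumr -big_split; apply: eq_bigr => a _ /=.
by rewrite !ffunE scalerDl scalerA.
Qed.

HB.instance Definition _ :=
  GRing.isLinear.Build H Omega11 Omega11 _ Psi Psi_is_linear.

Lemma rmul11_sum J (r : seq J) (P : pred J) (F : J -> Omega11) f :
  rmul11 (\sum_(j <- r | P j) F j) f = \sum_(j <- r | P j) rmul11 (F j) f.
Proof.
apply: (big_morph (rmul11^~ f) (rmul11Dl f)).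
by apply: (addIr (rmul11 0 f)); rewrite -rmul11Dl !add0r.
Qed.

Lemma Psi_rmul w f : Psi (rmul11 w f) = rmul11 (Psi w) f.
Proof.
rewrite /Psi rmul11_sum; apply: eq_bigr => b _.
rewrite rmul11_sum; apply: eq_bigr => a _.
rewrite rmul11Z rmul11_tensor rmul1_mc /tensor11.
rewrite -(tensor_balanced rmul1A) rmul1_mc Rtrans_comp.
rewrite [tensor _ (_ *: _) _]tensor11Z scalerA.
by rewrite !ffunE Rtrans_comp mulgVK.
Qed.

Lemma Psi_tensor (a b : gT) : a \in C -> b \in C ->
  Psi (tensor11 (mc a) (mc b)) = tensor11 (mc (a * b * a^-1)%g) (mc a).
Proof.
move=> aC bC; rewrite /Psi (bigD1 (Sub b bC)) //= (bigD1 (Sub a aC)) //=.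
have R0 x : Rtrans x 0 = 0 by apply/ffunP => y; rewrite !ffunE.
rewrite !ffunE !SubK !eqxx Rtrans1 mulr1 scale1r !big1 ?addr0 //.
  move=> d nd; apply: big1 => c _; rewrite !ffunE.
  have /negPf-> : val d != b by rewrite -(inj_eq val_inj) SubK in nd.
  by rewrite R0 mulr0 scale0r.
move=> c nc; rewrite !ffunE.
have /negPf-> : val c != a by rewrite -(inj_eq val_inj) SubK in nc.
by rewrite mul0r scale0r.
Qed.

Definition ker_id_Psi : {pred Omega11} := [pred w | w - Psi w == 0].

Lemma ker_id_Psi_zmod_closed : zmod_closed ker_id_Psi.
Proof.
split=> [|u v]; rewrite !inE; first by rewrite raddf0 subr0.
move=> /eqP u0 /eqP v0.
by rewrite raddfB opprD addrACA -opprD u0 v0 subr0.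
Qed.

HB.instance Definition _ :=
  GRing.isZmodClosed.Build Omega11 ker_id_Psi ker_id_Psi_zmod_closed.

Definition Omega2 := {ideal_quot ker_id_Psi}.
HB.instance Definition _ := GRing.Zmodule.on Omega2.

(* Locked, to keep unification from unfolding the quotient. *)
Definition pi2 (w : Omega11) : Omega2 :=
  locked \pi_({ideal_quot ker_id_Psi})%qT w.

Lemma pi2E w : pi2 w = \pi_({ideal_quot ker_id_Psi})%qT w.
Proof. by rewrite /pi2 -lock. Qed.

Lemma pi2P u v : reflect (pi2 u = pi2 v) (u - v \in ker_id_Psi).
Proof. by rewrite !pi2E Quotient.idealrBE; apply: eqP. Qed.

Lemma pi2_0 : pi2 0 = 0.
Proof. by rewrite pi2E raddf0. Qed.

Lemma pi2D : {morph pi2 : u v / u + v}.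
Proof. by move=> u v; rewrite !pi2E raddfD. Qed.

Lemma pi2_repr (w : Omega2) : pi2 (generic_quotient.repr w) = w.
Proof. by rewrite pi2E; apply: reprK. Qed.

(* The two actions of H on the quotient are induced by those on
   Omega^1 (x)_H Omega^1; lmul2E and rmul2E state that they are well defined. *)
Definition lmul2 (f : H) (w : Omega2) : Omega2 :=
  pi2 (f *: generic_quotient.repr w).
Definition rmul2 (w : Omega2) (f : H) : Omega2 :=
  pi2 (rmul11 (generic_quotient.repr w) f).

Lemma lmul2E f w : lmul2 f (pi2 w) = pi2 (f *: w).
Proof.
apply/pi2P; rewrite -scalerBr inE linearZ -scalerBr.
have /pi2P := pi2_repr (pi2 w).
by rewrite inE => /eqP->; rewrite scaler0.
Qed.

Lemma rmul11B f : {morph rmul11^~ f : u v / u - v}.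
Proof.
by move=> u v; apply: (addIr (rmul11 v f)); rewrite -rmul11Dl !subrK.
Qed.

Lemma rmul2E w f : rmul2 (pi2 w) f = pi2 (rmul11 w f).
Proof.
apply/pi2P; rewrite -rmul11B inE Psi_rmul -rmul11B.
have /pi2P := pi2_repr (pi2 w); rewrite inE => /eqP->.
by have := rmul11B f 0 0; rewrite !subrr => ->.
Qed.

Lemma lmul2A f g w : lmul2 f (lmul2 g w) = lmul2 (f * g) w.
Proof. by rewrite -[w]pi2_repr !lmul2E scalerA. Qed.
Lemma lmul2_1 : left_id 1 lmul2.
Proof. by move=> w; rewrite -[w]pi2_repr lmul2E scale1r. Qed.
Lemma lmul2Dr : right_distributive lmul2 +%R.
Proof.
move=> f u v; rewrite -[u]pi2_repr -[v]pi2_repr -pi2D !lmul2E.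
by rewrite scalerDr pi2D.
Qed.
Lemma lmul2Dl w : {morph lmul2^~ w : f g / f + g}.
Proof. by move=> f g; rewrite -[w]pi2_repr !lmul2E scalerDl pi2D. Qed.

HB.instance Definition _ :=
  GRing.Zmodule_isLmodule.Build H Omega2 lmul2A lmul2_1 lmul2Dr lmul2Dl.

Lemma rmul2Dl f : {morph rmul2^~ f : u v / u + v}.
Proof.
move=> u v; rewrite -[u]pi2_repr -[v]pi2_repr -pi2D !rmul2E.
by rewrite rmul11Dl pi2D.
Qed.
Lemma rmul2Dr w : {morph rmul2 w : f g / f + g}.
Proof. by move=> f g; rewrite -[w]pi2_repr !rmul2E rmul11Dr pi2D. Qed.
Lemma rmul2A w f g : rmul2 (rmul2 w f) g = rmul2 w (f * g).
Proof. by rewrite -[w]pi2_repr !rmul2E rmul11A. Qed.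
Lemma rmul2_1 w : rmul2 w 1 = w.
Proof. by rewrite -[w]pi2_repr rmul2E rmul11_1. Qed.

Local Notation Omega21 := {ffun I -> Omega2}.

Definition tensor21 (w : Omega2) (alpha : Omega1) : Omega21 :=
  tensor rmul2 w alpha.

Definition wedge (alpha beta : Omega1) : Omega2 := pi2 (tensor11 alpha beta).

Definition dmc (a : gT) : Omega2 := wedge theta (mc a) + wedge (mc a) theta.

Definition d1 (alpha : Omega1) : Omega2 :=
  \sum_(a : I) (wedge (d0 (alpha a)) (mc (val a)) + (alpha a : H) *: dmc (val a)).

Lemma d1_mc (a : gT) : a \in C -> d1 (mc a) = dmc a.
Proof.
move=> aC.
have w0 beta : wedge 0 beta = 0.
  rewrite /wedge; have -> : tensor11 0 beta = 0.
    by apply/ffunP => b; apply/ffunP => c; rewrite !ffunE mul0r.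
  exact: pi2_0.
have d0_mc b : d0 (mc a b) = 0.
  rewrite /d0 big1 // => c _; rewrite ffunE.
  have -> : Rtrans (val c) (val b == a)%:R = (val b == a)%:R.
    by case: eqP => _; apply/ffunP => x; rewrite !ffunE.
  by rewrite subrr scale0r.
rewrite /d1 (bigD1 (Sub a aC)) //= big1 ?addr0.
  by rewrite d0_mc w0 add0r ffunE SubK eqxx scale1r.
move=> b nb; rewrite d0_mc w0 add0r ffunE.
have /negPf-> : val b != a by rewrite -(inj_eq val_inj) SubK in nb.
by rewrite scale0r.
Qed.

Definition regular (A : I -> Omega1) : Prop :=
  forall g : gT, g != 1%g -> g \notin C ->
    \sum_(a : I) \sum_(b : I | (val a * val b)%g == g) wedge (A a) (A b) = 0.

Record regular_connection := RegularConnection {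
  rconn :> I -> Omega1;
  rconnP : regular rconn
}.

Definition cov_deriv (A : I -> Omega1) (alpha : Omega1) : Omega11 :=
  \sum_(a : I) tensor11 (d0 (alpha a)) (mc (val a))
  - \sum_(a : I) (alpha a : H) *:
      \sum_(b : I) tensor11 (A b) (mc ((val b)^-1 * val a * val b)%g - mc (val a)).

Definition curvature (A : regular_connection) (a : I) : Omega2 :=
  d1 (A a)
  + \sum_(c : I) \sum_(d : I | (val c * val d)%g == val a) wedge (A c) (A d)
  - \sum_(c : I) (wedge (A c) (A a) + wedge (A a) (A c)).

Definition riemann (A : regular_connection) (alpha : Omega1) : Omega21 :=
  \sum_(a : I) (alpha a : H) *:
    \sum_(b : I) tensor21 (curvature A b)
      (mc ((val b)^-1 * val a * val b)%g - mc (val a)).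

End Calculus.


Section WedgeTheory.

Variables (K : fieldType) (gT : finGroupType) (C : {set gT}).
Local Notation H := {ffun gT -> K}.
Local Notation I := {a : gT | a \in C}.
Local Notation Omega1 := {ffun I -> H^o}.
Implicit Types alpha beta : Omega1.

Lemma wedgeDl beta : {morph (@wedge K gT C)^~ beta : u v / u + v}.
Proof.
by move=> u v; rewrite /wedge /tensor11 (tensorDl (@rmul1Dl _ _ _)) pi2D.
Qed.

Lemma wedgeDr alpha : {morph wedge alpha : u v / u + v}.
Proof.
by move=> u v; rewrite /wedge /tensor11 (tensorDr (@rmul1Dr _ _ _)) pi2D.
Qed.

Lemma wedgeZl f alpha beta : wedge (f *: alpha) beta = f *: wedge alpha beta.
Proof. by rewrite /wedge tensor11Z [RHS]lmul2E. Qed.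

Lemma wedge_cstr (c : K) alpha beta :
  wedge alpha (cst gT c *: beta) = cst gT c *: wedge alpha beta.
Proof.
rewrite -wedgeZl /wedge; congr pi2; rewrite /tensor11.
rewrite -(tensor_balanced (@rmul1A _ _ _)); congr tensor.
apply/ffunP => a; rewrite !ffunE [RHS]HmulC; congr (_ * _).
by apply/ffunP => g; rewrite !ffunE.
Qed.

Lemma wedge_suml J (r : seq J) P (F : J -> Omega1) beta :
  wedge (\sum_(j <- r | P j) F j) beta = \sum_(j <- r | P j) wedge (F j) beta.
Proof.
apply: (big_morph (fun u => wedge u beta) (wedgeDl beta)).
by apply: (addIr (wedge 0 beta)); rewrite -wedgeDl !add0r.
Qed.

Lemma wedge_sumr J (r : seq J) P (F : J -> Omega1) alpha :
  wedge alpha (\sum_(j <- r | P j) F j) = \sum_(j <- r | P j) wedge alpha (F j).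
Proof.
apply: (big_morph (wedge alpha) (wedgeDr alpha)).
by apply: (addIr (wedge alpha 0)); rewrite -wedgeDr !add0r.
Qed.

Lemma pi2_fixed (w : {ffun I -> Omega1}) : Psi w = w -> pi2 w = 0.
Proof.
move=> fw; rewrite -(@pi2_0 K gT C).
by apply/pi2P; rewrite subr0 inE fw subrr.
Qed.

(* A sum of e_a /\ e_b whose terms are permuted by Psi vanishes. *)
Lemma wedge_sum_eq0 (J : finType) (u v : J -> I) :
    \sum_j tensor11 (mc K C (val (u j) * val (v j) * (val (u j))^-1)%g)
                    (mc K C (val (u j)))
      = \sum_j tensor11 (mc K C (val (u j))) (mc K C (val (v j))) ->
  \sum_j wedge (mc K C (val (u j))) (mc K C (val (v j))) = 0.
Proof.
move=> E; rewrite /wedge.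
rewrite -(big_morph _ (@pi2D K gT C) (@pi2_0 K gT C)); apply: pi2_fixed.
rewrite raddf_sum -E; apply: eq_bigr => j _.
by rewrite /= Psi_tensor ?(valP (u j)) ?(valP (v j)).
Qed.

Local Notation e := (mc K C).
Local Notation th := (theta K C).

Lemma sum_mc_inj (h : I -> I) : injective h -> \sum_a e (val (h a)) = th.
Proof. by move=> hI; rewrite /theta [RHS](reindex_inj hI). Qed.

Let mkI (a : gT) (aC : a \in C) : I := exist (fun b => b \in C) a aC.

Hypothesis CVMM : forall a b c, a \in C -> b \in C -> c \in C ->
  (c^-1 * (a * b))%g \in C.
Hypothesis CMMV : forall a b c, a \in C -> b \in C -> c \in C ->
  (a * b * c^-1)%g \in C.

Lemma wedge_theta : wedge th th = 0.
Proof.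
rewrite /theta wedge_suml; under eq_bigr do rewrite wedge_sumr.
rewrite pair_bigA /=.
apply: (@wedge_sum_eq0 _ (fun p : I * I => p.1) (fun p => p.2)).
pose h (p : I * I) : I * I :=
  (mkI (CMMV (valP p.1) (valP p.2) (valP p.1)), p.1).
have hI : injective h.
  move=> [a b] [c d] E; have E2 : a = c := congr1 snd E; rewrite -{}E2 in E *.
  congr pair; apply: val_inj; apply: (mulgI (val a)).
  apply: (mulIg (val a)^-1%g); exact: (congr1 (fun p => val p.1) E).
by rewrite [RHS](reindex_inj hI).
Qed.

Lemma wedge_pairs_eq0 (g : gT) (s : I -> I) :
    (forall a, val a * val (s a) = g)%g ->
    (forall b : I, g * (val b)^-1 \in C)%g ->
  \sum_a wedge (e (val a)) (e (val (s a))) = 0.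
Proof.
move=> sE gV; apply: (@wedge_sum_eq0 _ id s).
pose h (a : I) : I := mkI (gV a).
have hI : injective h by move=> a b /(congr1 val)/mulgI/invg_inj/val_inj.
rewrite [RHS](reindex_inj hI); apply: eq_bigr => a _; rewrite sE.
congr (tensor11 _ (mc K C _)).
by apply: (mulgI (val (h a))); rewrite sE /= mulgKV.
Qed.

Lemma mc_sub_theta_regular (k : K) :
  regular (fun a : I => e (val a) - cst gT k *: th).
Proof.
move=> g _ _.
have [[a0 b0] /eqP E0|noab] := pickP (fun p : I * I => val p.1 * val p.2 == g)%g;
  last first.
  rewrite big1 // => a _; rewrite big_pred0 // => b; exact: noab (a, b).
have sC (a : I) : ((val a)^-1 * g)%g \in C.
  by rewrite -E0; apply: CVMM; apply: valP.
have gV (b : I) : (g * (val b)^-1)%g \in C.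
  by rewrite -E0; apply: CMMV; apply: valP.
pose s (a : I) : I := mkI (sC a).
have sE a : (val a * val (s a))%g = g by rewrite SubK mulKVg.
have sI : injective s by move=> a b /(congr1 val)/mulIg/invg_inj/val_inj.
pose k' := cst gT (- k).
have lcE a : e (val a) - cst gT k *: th = e (val a) + k' *: th.
  rewrite /k' -scaleNr; congr (_ + _ *: _).
  by apply/ffunP => x; rewrite !ffunE.
have wE a : wedge (e (val a) - cst gT k *: th) (e (val (s a)) - cst gT k *: th)
    = wedge (e (val a)) (e (val (s a)))
    + k' *: wedge (e (val a)) th + k' *: wedge th (e (val (s a))).
  rewrite !lcE wedgeDl !wedgeDr !wedgeZl !wedge_cstr wedge_theta.
  by rewrite !scaler0 addr0.
under eq_bigr => a _.
  rewrite (big_pred1 (s a)); last first.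
    move=> b; rewrite -(sE a) (inj_eq (mulgI _)); exact: val_eqE.
  rewrite wE; over.
rewrite !big_split /= (wedge_pairs_eq0 sE gV) -!scaler_sumr -wedge_suml -wedge_sumr.
by rewrite (sum_mc_inj sI) -/th wedge_theta !scaler0 !addr0.
Qed.

End WedgeTheory.

(* The alternating group with products composed right to left; the product of
   {perm T} is composed left to right. *)
Definition alt4 := {s : {perm 'I_4} | s \in ('Alt_('I_4))%g}.
HB.instance Definition _ := Finite.on alt4.

Definition alt4_mul (a b : alt4) : alt4 :=
  Sub (val b * val a)%g (groupM (valP b) (valP a)).
Definition alt4_one : alt4 := Sub 1%g (group1 _).
Definition alt4_inv (a : alt4) : alt4 := Sub (val a)^-1%g (groupVr (valP a)).

Lemma alt4_mulA : associative alt4_mul.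
Proof. by move=> a b c; apply: val_inj; rewrite !SubK mulgA. Qed.
Lemma alt4_mul1 : left_id alt4_one alt4_mul.
Proof. by move=> a; apply: val_inj; rewrite !SubK mulg1. Qed.
Lemma alt4_mulV : left_inverse alt4_one alt4_inv alt4_mul.
Proof. by move=> a; apply: val_inj; rewrite !SubK mulgV. Qed.

HB.instance Definition _ := Finite_isGroup.Build alt4 alt4_mulA alt4_mul1 alt4_mulV.

Definition A4 : finGroupType := alt4.

Lemma A4_mulE (a b : A4) (i : 'I_4) : val (a * b)%g i = val a (val b i).
Proof. by rewrite SubK permM. Qed.

(* The 3-cycle (i j k): the transposition (i j) is applied first. *)
Definition cyc3 (i j k : 'I_4) : {perm 'I_4} := (tperm i j * tperm i k)%g.

Lemma cyc3_Alt i j k : i != j -> i != k -> cyc3 i j k \in ('Alt_('I_4))%g.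
Proof. by move=> ij ik; rewrite Alt_even odd_permM !odd_tperm ij ik. Qed.

Lemma cyc3E i j k : i != j -> j != k -> i != k ->
  [/\ cyc3 i j k i = j, cyc3 i j k j = k & cyc3 i j k k = i].
Proof.
move=> ij jk ik; rewrite !permM tpermL [tperm i j k]tpermD // !tpermR tpermL.
by rewrite tpermD // eq_sym.
Qed.

(* The set {1, 2, 3, 4} is encoded as {0, 1, 2, 3}. *)
Definition pt1 : 'I_4 := @Ordinal 4 0 isT.
Definition pt2 : 'I_4 := @Ordinal 4 1 isT.
Definition pt3 : 'I_4 := @Ordinal 4 2 isT.
Definition pt4 : 'I_4 := @Ordinal 4 3 isT.

Definition t : A4 := Sub (cyc3 pt1 pt2 pt3) (@cyc3_Alt pt1 pt2 pt3 isT isT).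
Definition x : A4 := Sub (cyc3 pt1 pt3 pt4) (@cyc3_Alt pt1 pt3 pt4 isT isT).
Definition y : A4 := Sub (cyc3 pt2 pt4 pt3) (@cyc3_Alt pt2 pt4 pt3 isT isT).
Definition z : A4 := Sub (cyc3 pt1 pt4 pt2) (@cyc3_Alt pt1 pt4 pt2 isT isT).

Definition code (s : A4) : seq nat :=
  [seq nat_of_ord (val s i) | i <- [:: pt1; pt2; pt3; pt4]].

Lemma code_inj : injective code.
Proof.
move=> a b [e1 e2 e3 e4]; apply/val_inj/permP => i; apply/val_inj.
case: i => [[|[|[|[|//]]]] lti] /=.
- by rewrite (_ : Ordinal lti = pt1) //; apply: val_inj.
- by rewrite (_ : Ordinal lti = pt2) //; apply: val_inj.
- by rewrite (_ : Ordinal lti = pt3) //; apply: val_inj.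
- by rewrite (_ : Ordinal lti = pt4) //; apply: val_inj.
Qed.

Lemma codeM (a b : A4) : code (a * b)%g = [seq nth 0%N (code a) i | i <- code b].
Proof.
have codeE (i : 'I_4) : nth 0%N (code a) i = val a i :> nat.
  case: i => [[|[|[|[|//]]]] lti] /=.
  - by rewrite (_ : Ordinal lti = pt1) //; apply: val_inj.
  - by rewrite (_ : Ordinal lti = pt2) //; apply: val_inj.
  - by rewrite (_ : Ordinal lti = pt3) //; apply: val_inj.
  - by rewrite (_ : Ordinal lti = pt4) //; apply: val_inj.
by rewrite -map_comp; apply: eq_map => i /=; rewrite A4_mulE -codeE.
Qed.

Lemma code_gen : [/\ code t = [:: 1; 2; 0; 3]%N, code x = [:: 2; 1; 3; 0]%N,
  code y = [:: 0; 3; 1; 2]%N & code z = [:: 3; 0; 2; 1]%N].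
Proof.
by split; rewrite /code /= !permM !permE /=.
Qed.

Definition calC : {set A4} := [set t; x; y; z].

Lemma mem_calC (a : A4) : (a \in calC) =
  (code a \in [:: [:: 1; 2; 0; 3]; [:: 2; 1; 3; 0]; [:: 0; 3; 1; 2];
                  [:: 3; 0; 2; 1]]%N).
Proof.
have [<- <- <- <-] := code_gen.
by rewrite !inE !(inj_eq code_inj) -!orbA.
Qed.

Lemma calC_ind (P : A4 -> Prop) :
  P t -> P x -> P y -> P z -> forall a, a \in calC -> P a.
Proof. by move=> Pt Px Py Pz a; rewrite !inE => /orP[/orP[/orP[]|]|] /eqP->. Qed.

Lemma calC_inv : forall a : A4, a \in calC -> (a^-1 = a * a)%g.
Proof.
have [et ex ey ez] := code_gen.
have e1 : code 1%g = [:: 0; 1; 2; 3]%N by rewrite /code /= !perm1.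
move=> a aC; apply: (mulgI a); rewrite mulgV; apply: code_inj.
by rewrite !codeM e1; move: a aC; apply: calC_ind; rewrite ?et ?ex ?ey ?ez.
Qed.

Lemma calC_VMM (a b c : A4) : a \in calC -> b \in calC -> c \in calC ->
  (c^-1 * (a * b))%g \in calC.
Proof.
have [et ex ey ez] := code_gen.
move=> aC bC cC; rewrite (calC_inv cC) mem_calC !codeM; move: a aC b bC c cC.
by apply: calC_ind; apply: calC_ind; apply: calC_ind; rewrite ?et ?ex ?ey ?ez.
Qed.

Lemma calC_MMV (a b c : A4) : a \in calC -> b \in calC -> c \in calC ->
  (a * b * c^-1)%g \in calC.
Proof.
have [et ex ey ez] := code_gen.
move=> aC bC cC; rewrite (calC_inv cC) mem_calC !codeM; move: a aC b bC c cC.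
by apply: calC_ind; apply: calC_ind; apply: calC_ind; rewrite ?et ?ex ?ey ?ez.
Qed.

Lemma card_calC : #|calC| = 4.
Proof.
have [et ex ey ez] := code_gen.
have U : uniq [:: t; x; y; z].
  by rewrite -(map_inj_uniq code_inj) /= et ex ey ez.
suff -> : #|calC| = #|[:: t; x; y; z]| by apply/card_uniqP.
by apply: eq_card => a; rewrite !inE /= -!orbA.
Qed.

Lemma card_A4 : #|{: A4}| = 12.
Proof.
have := @card_Alt 'I_4; rewrite card_ord card_sig => /(_ isT) AE.
by apply/eqP; rewrite -(eqn_pmul2l (isT : 0 < 2)%N) AE.
Qed.

Lemma calC_class : calC = (t ^: [set: A4])%g.
Proof.
have [et ex ey ez] := code_gen.
have tC : t \in calC by rewrite !inE eqxx.
apply/eqP; rewrite eqEcard; apply/andP; split.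
  apply/subsetP => a aC; apply/imsetP.
  have gen b c : b \in calC -> code (t * b)%g = code (b * c)%g -> c = (t ^ b)%g.
    by move=> _ /code_inj E; rewrite conjgE E mulKg.
  move: a aC; apply: calC_ind.
  - by exists t; rewrite ?inE // conjgE mulKg.
  - by exists y; rewrite ?inE //; apply: gen; rewrite ?codeM ?et ?ex ?ey ?inE ?eqxx ?orbT.
  - by exists z; rewrite ?inE //; apply: gen; rewrite ?codeM ?et ?ez ?ey ?inE ?eqxx ?orbT.
  - by exists x; rewrite ?inE //; apply: gen; rewrite ?codeM ?et ?ex ?ez ?inE ?eqxx ?orbT.
rewrite card_calC -index_cent1.
have t3 : #[t]%g = 3.
  apply: nt_prime_order => //.
    by rewrite expgS -[(t ^+ 2)%g]/(t * t)%g -(calC_inv tC) mulgV.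
  by apply/eqP => /(congr1 code); rewrite et /code /= !perm1.
have sub : (<[t]> \subset 'C_[set: A4][t])%g.
  by rewrite subsetI subsetT cycle_subG cent1id.
have /dvdn_leq := cardSg sub; rewrite -orderE t3 cardG_gt0 => /(_ isT) le3.
have := Lagrange (subsetIl [set: A4] 'C[t])%g.
rewrite /= cardsT card_A4 => E; rewrite leqNgt; apply/negP => gt4.
by have := leq_mul le3 gt4; rewrite E.
Qed.

Section LeviCivita.

Variable R : realType.

Definition CC : fieldType := R[i].

Local Notation e := (mc CC calC).
Local Notation theta := (theta CC calC).

Definition lc_form (a : {a : A4 | a \in calC}) :
    {ffun {a : A4 | a \in calC} -> {ffun A4 -> CC}^o} :=
  e (val a) - cst A4 (1 / 4%:R) *: theta.

Lemma lc_regular : regular lc_form.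
Proof. exact: mc_sub_theta_regular calC_VMM calC_MMV _. Qed.

Definition levi_civita : regular_connection CC calC :=
  RegularConnection lc_regular.

End LeviCivita.

Notation "alpha \ox beta" := (tensor11 alpha beta)
  (at level 30, right associativity) : ring_scope.
Notation "w \oxx alpha" := (tensor21 w alpha)
  (at level 30, right associativity) : ring_scope.

(* Main.v *)
Require Import Defs.
From mathcomp Require Import all_boot all_order all_algebra all_fingroup.
From mathcomp Require Import reals complex.

Set Implicit Arguments.
Unset Strict Implicit.
Unset Printing Implicit Defensive.

Import GRing.Theory Num.Theory.
Local Open Scope ring_scope.

(* Subtracting theta / |C| makes the connection forms A_b = e_b - theta / |C| sum
   to zero. This removes the -e_a terms of nabla(e_a) and the quadratic terms
   A_c /\ A_a + A_a /\ A_c of the curvature; conjugation of a fixed a in C by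
   all b in C permutes C, whence the theta (x) theta term. No product of two
   elements of C lies in C, a coset of V_4 generating A_4/V_4 = Z/3, so F_a = dA_a.
   Finally d theta = 2 theta /\ theta = 0 gives F_a = de_a, and \sum_b F_b = 0
   removes the -e_a terms of the Riemann curvature. *)

(** * Additivity of the tensor products and of the wedge product *)

Section Bilinearity.

Variables (K : fieldType) (gT : finGroupType) (C : {set gT}).

Local Notation H := {ffun gT -> K}.
Local Notation I := {a : gT | a \in C}.
Local Notation Omega1 := {ffun I -> H^o}.
Implicit Types (alpha beta : Omega1) (w : Omega2 K C).

Lemma tensor11Dl beta : {morph (@tensor11 K gT C)^~ beta : u v / u + v}.
Proof. exact/tensorDl/rmul1Dl. Qed.

Lemma tensor11Dr alpha : {morph tensor11 alpha : u v / u + v}.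
Proof. exact/tensorDr/rmul1Dr. Qed.

Lemma tensor11Bl beta : {morph (@tensor11 K gT C)^~ beta : u v / u - v}.
Proof.
by move=> u v; apply: (addIr (tensor11 v beta)); rewrite -tensor11Dl !subrK.
Qed.

Lemma tensor11Br alpha : {morph tensor11 alpha : u v / u - v}.
Proof.
by move=> u v; apply: (addIr (tensor11 alpha v)); rewrite -tensor11Dr !subrK.
Qed.

Lemma tensor11_0l beta : tensor11 0 beta = 0.
Proof. by rewrite -[0 in LHS](subrr 0) tensor11Bl subrr. Qed.

Lemma tensor11_suml J (r : seq J) (P : pred J) (F : J -> Omega1) beta :
  tensor11 (\sum_(j <- r | P j) F j) beta
    = \sum_(j <- r | P j) tensor11 (F j) beta.
Proof.
exact: (big_morph (fun u => tensor11 u beta)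
                  (tensor11Dl beta) (tensor11_0l beta)).
Qed.

Lemma tensor11_sumr J (r : seq J) (P : pred J) (F : J -> Omega1) alpha :
  tensor11 alpha (\sum_(j <- r | P j) F j)
    = \sum_(j <- r | P j) tensor11 alpha (F j).
Proof.
apply: (big_morph (tensor11 alpha) (tensor11Dr alpha)).
by apply: (addIr (tensor11 alpha 0)); rewrite -tensor11Dr !add0r.
Qed.

Lemma tensor21Dl alpha : {morph (@tensor21 K gT C)^~ alpha : u v / u + v}.
Proof. exact/tensorDl/rmul2Dl. Qed.

Lemma tensor21Br w : {morph tensor21 w : u v / u - v}.
Proof.
move=> u v; apply: (addIr (tensor21 w v)).
by rewrite -(tensorDr (@rmul2Dr K gT C)) !subrK.
Qed.

Lemma tensor21_0l alpha : tensor21 (0 : Omega2 K C) alpha = 0.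
Proof.
by apply: (addIr (tensor21 0 alpha)); rewrite -tensor21Dl !add0r.
Qed.

Lemma tensor21_suml J (r : seq J) (P : pred J) (F : J -> Omega2 K C) alpha :
  tensor21 (\sum_(j <- r | P j) F j) alpha
    = \sum_(j <- r | P j) tensor21 (F j) alpha.
Proof.
exact: (big_morph (fun u => tensor21 u alpha)
                  (tensor21Dl alpha) (tensor21_0l alpha)).
Qed.

Lemma wedge0l beta : wedge 0 beta = 0.
Proof. by rewrite /wedge tensor11_0l pi2_0. Qed.

Lemma wedge0r alpha : wedge alpha 0 = 0.
Proof. by apply: (addIr (wedge alpha 0)); rewrite -wedgeDr !add0r. Qed.

End Bilinearity.

(** * The connection $e_a - k\theta$ with $k = 1/|C|$, for a general finite group *)

Section ShiftedMaurerCartan.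

Variables (K : fieldType) (gT : finGroupType) (C : {set gT}).

Local Notation H := {ffun gT -> K}.
Local Notation I := {a : gT | a \in C}.
Local Notation Omega1 := {ffun I -> H^o}.
Local Notation e := (mc K C).
Local Notation th := (theta K C).

Lemma d0_cst (c : K) : d0 C (cst gT c) = 0.
Proof.
rewrite /d0 big1 // => a _.
have -> : Rtrans (val a) (cst gT c) = cst gT c.
  by apply/ffunP => g; rewrite !ffunE.
by rewrite subrr scale0r.
Qed.

(** Constants are killed by [d0], so only the $\alpha^a\,\mathrm{d}e_a$ terms of [d1] survive. *)
Lemma d1_cst_coef (c : I -> K) :
  d1 [ffun a => cst gT (c a) : H^o] = \sum_a cst gT (c a) *: dmc K C (val a).
Proof.
by apply: eq_bigr => a _; rewrite ffunE d0_cst wedge0l add0r.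
Qed.

Lemma mc_coef (a : gT) (b : I) : e a b = cst gT (val b == a)%:R.
Proof. by rewrite ffunE; apply/ffunP => g; case: eqP; rewrite !ffunE. Qed.

Lemma theta_coef (b : I) : th b = 1.
Proof.
rewrite /theta sum_ffunE (bigD1 b) //= big1 ?addr0 ?mc_delta // => a nab.
by rewrite ffunE eq_sym (inj_eq val_inj) (negPf nab).
Qed.

(** The coefficients of $e_a$ are Kronecker deltas. This evaluates at $e_a$ the sums $\sum_b
    \alpha^b F_b$ that define [cov_deriv] and [riemann]. *)
Lemma sum_mc_scale (Z : lmodType H) (a : gT) (aC : a \in C) (F : I -> Z) :
  \sum_b (e a b : H) *: F b = F (Sub a aC).
Proof.
rewrite (bigD1 (Sub a aC)) //= big1 ?addr0.
  by rewrite ffunE SubK eqxx scale1r.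
move=> b nb; rewrite ffunE.
have /negPf-> : val b != a by rewrite -(inj_eq val_inj) SubK in nb.
by rewrite scale0r.
Qed.

Variable k : K.
Hypothesis kC : k * #|C|%:R = 1.

(** The Levi-Civita form when $|C| = 4$: [kC] states $k = 1/|C|$ without a division and makes $|C|$
    invertible in [K]. *)
Definition shifted_mc (a : I) : Omega1 := e (val a) - cst gT k *: th.

Lemma cst_scale_card (V : lmodType H) (v : V) : cst gT k *: v *+ #|C| = v.
Proof.
rewrite -[in RHS](scale1r v) scalerMnl; congr (_ *: _).
by apply/ffunP => g; rewrite ffunMnE !ffunE -mulr_natr.
Qed.

Lemma sum_shifted_mc : \sum_a shifted_mc a = 0.
Proof.
by rewrite sumrB sumr_const card_sig cst_scale_card subrr.
Qed.

Hypothesis conj_theta :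
  forall a, a \in C -> \sum_(b : I) e ((val b)^-1 * a * val b)%g = th.

Lemma cov_deriv_shifted_mc (a : gT) : a \in C ->
  cov_deriv shifted_mc (e a)
    = - (\sum_(b : I) tensor11 (e (val b)) (e ((val b)^-1 * a * val b)%g))
      + cst gT k *: tensor11 th th.
Proof.
move=> aC; rewrite /cov_deriv sum_mc_scale big1 ?sub0r; last first.
  by move=> b _; rewrite mc_coef d0_cst tensor11_0l.
(* Only the conjugate term has $A_b$ expanded; in the $-e_a$ term $A_b$ stays whole, so that $\sum_b
   A_b = 0$ applies there. *)
under eq_bigr => b _ do
  rewrite tensor11Br [X in X - _]tensor11Bl tensor11Z.
rewrite /= 2!sumrB -scaler_sumr -tensor11_sumr conj_theta //.
rewrite -tensor11_suml sum_shifted_mc tensor11_0l.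
by rewrite subr0 opprB addrC.
Qed.

Hypothesis theta2 : wedge th th = 0.

Lemma sum_d1_mc : \sum_(a : I) d1 (e (val a)) = 0.
Proof.
under eq_bigr => a _ do rewrite (d1_mc K (valP a)) /dmc.
by rewrite big_split /= -wedge_sumr -wedge_suml theta2 addr0.
Qed.

(** All coefficients of $A_a$ are constants, so the shift by $k\theta$ contributes $k\sum_b
    \mathrm{d}e_b = 0$. *)
Lemma d1_shifted_mc (a : I) : d1 (shifted_mc a) = d1 (e (val a)).
Proof.
rewrite [RHS](d1_mc K (valP a)).
pose c (b : I) := (val b == val a)%:R - k.
have -> : shifted_mc a = [ffun b => cst gT (c b) : H^o].
  apply/ffunP => b; rewrite [RHS]ffunE ffunE mc_coef 2!ffunE theta_coef.
  by rewrite [X in _ - X]mulr1; apply/ffunP => g; rewrite !ffunE.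
rewrite d1_cst_coef.
have cE b : cst gT (c b) = (e (val a) b : H) - cst gT k.
  by rewrite mc_coef; apply/ffunP => g; rewrite !ffunE.
under eq_bigr do rewrite cE scalerBl.
rewrite sumrB (sum_mc_scale (valP a)) SubK -scaler_sumr.
(* Going back from [dmc] to [d1] gives the sum the shape of [sum_d1_mc]. *)
under [X in _ - _ *: X]eq_bigr => b _ do rewrite -(d1_mc K (valP b)).
by rewrite sum_d1_mc scaler0 subr0.
Qed.

Hypothesis noMM : forall a b, a \in C -> b \in C -> (a * b)%g \notin C.

Variable A : regular_connection K C.
Hypothesis AE : forall a, A a = shifted_mc a.

Lemma curvature_shifted_mc (a : I) : curvature A a = d1 (e (val a)).
Proof.
rewrite /curvature AE d1_shifted_mc.
(* The sum over $cd = a$ is empty by [noMM]. *)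
rewrite [X in _ + X - _]big1 => [|c _]; last first.
  rewrite big_pred0 // => d; apply: contraNF (noMM (valP c) (valP d)).
  by move/eqP->; apply: valP.
rewrite addr0 big_split /= -wedge_suml -wedge_sumr.
under eq_bigr do rewrite AE.
by rewrite sum_shifted_mc wedge0l wedge0r addr0 subr0.
Qed.

Lemma riemann_shifted_mc (a : gT) : a \in C ->
  riemann A (e a)
    = \sum_(b : I) tensor21 (d1 (e (val b))) (e ((val b)^-1 * a * val b)%g).
Proof.
move=> aC; rewrite /riemann sum_mc_scale.
under eq_bigr do rewrite curvature_shifted_mc tensor21Br.
by rewrite sumrB -tensor21_suml sum_d1_mc tensor21_0l subr0.
Qed.

End ShiftedMaurerCartan.

(** * Products and conjugates in the class $\{t,x,y,z\}$ *)

Lemma calC_mul_notin (a b : A4) :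
  a \in calC -> b \in calC -> (a * b)%g \notin calC.
Proof.
have [et ex ey ez] := code_gen.
move=> aC bC; rewrite mem_calC !codeM; move: a aC b bC.
by apply: calC_ind; apply: calC_ind; rewrite ?et ?ex ?ey ?ez.
Qed.

Lemma calC_uniq : uniq [:: t; x; y; z].
Proof.
have [et ex ey ez] := code_gen.
by rewrite -(map_inj_uniq code_inj) /= et ex ey ez.
Qed.

(** [F] is taken on the whole group so that the four terms carry no membership proofs. *)
Lemma big_calC (V : nmodType) (F : A4 -> V) :
  \sum_(a : {a : A4 | a \in calC}) F (val a) = F t + F x + F y + F z.
Proof.
rewrite -big_sub (eq_bigl (mem [:: t; x; y; z])); last first.
  by move=> a; rewrite !inE -!orbA.
by rewrite -big_uniq ?calC_uniq //= !big_cons big_nil addr0 !addrA.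
Qed.

(** Rewriting $b^{-1}ab = c$ as $ab = bc$ removes the inverse and leaves products, which [codeM]
    computes. *)
Lemma calC_conjE (a b c : A4) : code (a * b)%g = code (b * c)%g ->
  (b^-1 * a * b)%g = c.
Proof. by move=> /code_inj E; rewrite -mulgA E mulKg. Qed.

(** In this table and the next three, conjugation fixes the conjugating element and cycles the other
    three. The indices in the eight formulas are read off from them. *)
Lemma conj_by_t : [/\ t^-1 * t * t = t, t^-1 * x * t = y,
  t^-1 * y * t = z & t^-1 * z * t = x]%g.
Proof.
have [et ex ey ez] := code_gen.
by split; apply: calC_conjE; rewrite !codeM ?et ?ex ?ey ?ez.
Qed.

Lemma conj_by_x : [/\ x^-1 * t * x = z, x^-1 * x * x = x,
  x^-1 * y * x = t & x^-1 * z * x = y]%g.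
Proof.
have [et ex ey ez] := code_gen.
by split; apply: calC_conjE; rewrite !codeM ?et ?ex ?ey ?ez.
Qed.

Lemma conj_by_y : [/\ y^-1 * t * y = x, y^-1 * x * y = z,
  y^-1 * y * y = y & y^-1 * z * y = t]%g.
Proof.
have [et ex ey ez] := code_gen.
by split; apply: calC_conjE; rewrite !codeM ?et ?ex ?ey ?ez.
Qed.

Lemma conj_by_z : [/\ z^-1 * t * z = y, z^-1 * x * z = t,
  z^-1 * y * z = x & z^-1 * z * z = z]%g.
Proof.
have [et ex ey ez] := code_gen.
by split; apply: calC_conjE; rewrite !codeM ?et ?ex ?ey ?ez.
Qed.

Lemma calC_conj_theta (K : fieldType) (a : A4) : a \in calC ->
  \sum_(b : {b : A4 | b \in calC}) mc K calC ((val b)^-1 * a * val b)%g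
    = theta K calC.
Proof.
(* In these names the first letter is the conjugated element and the second the conjugating one. *)
have [tt xt yt zt] := conj_by_t; have [tx xx yx zx] := conj_by_x.
have [ty xy yy zy] := conj_by_y; have [tz xz yz zz] := conj_by_z.
rewrite /theta (big_calC (mc K calC)) => aC.
rewrite (big_calC (fun b => mc K calC (b^-1 * a * b)%g)); move: a aC.
apply: calC_ind.
(* The conjugates of $t$ come in the order $t,z,x,y$; the pattern restores $t,x,y,z$. The other
   cases are similar. *)
- by rewrite tt tx ty tz [LHS](ACl (1*3*4*2)).
- by rewrite xt xx xy xz [LHS](ACl (4*2*1*3)).
- by rewrite yt yx yy yz [LHS](ACl (2*4*3*1)).
- by rewrite zt zx zy zz [LHS](ACl (3*1*2*4)).
Qed.

(** * The eight explicit formulas on $\mathcal{A}_4$ *)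

Theorem proposition4p2 (R : realType) :
  let e := mc (CC R) calC in
  let theta := theta (CC R) calC in
  let d := @d1 (CC R) A4 calC in
  let quarter := cst A4 (1 / 4%:R : CC R) in
  let nabla := cov_deriv (levi_civita R) in
  let Riem := riemann (levi_civita R) in
  [/\ nabla (e t) = - e t \ox e t - e x \ox e z - e y \ox e x - e z \ox e y
                    + quarter *: (theta \ox theta),
      nabla (e x) = - e t \ox e y - e x \ox e x - e y \ox e z - e z \ox e t
                    + quarter *: (theta \ox theta),
      nabla (e y) = - e t \ox e z - e x \ox e t - e y \ox e y - e z \ox e x
                    + quarter *: (theta \ox theta) &
      nabla (e z) = - e t \ox e x - e x \ox e y - e y \ox e t - e z \ox e z
                    + quarter *: (theta \ox theta)]
  /\
  [/\ Riem (e t) = d (e t) \oxx e t + d (e x) \oxx e z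
                   + d (e y) \oxx e x + d (e z) \oxx e y,
      Riem (e x) = d (e t) \oxx e y + d (e x) \oxx e x
                   + d (e y) \oxx e z + d (e z) \oxx e t,
      Riem (e y) = d (e t) \oxx e z + d (e x) \oxx e t
                   + d (e y) \oxx e y + d (e z) \oxx e x &
      Riem (e z) = d (e t) \oxx e x + d (e x) \oxx e y
                   + d (e y) \oxx e t + d (e z) \oxx e z].
Proof.
move=> e theta d quarter nabla Riem.
have [tt xt yt zt] := conj_by_t; have [tx xx yx zx] := conj_by_x.
have [ty xy yy zy] := conj_by_y; have [tz xz yz zz] := conj_by_z.
have [tC xC yC zC] : [/\ t \in calC, x \in calC, y \in calC & z \in calC].
  by rewrite !inE !eqxx !orbT.
(* Here $k = 1/4$ and $|\mathcal{C}| = 4$, which is nonzero in characteristic 0. *)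
have k4 : (1 / 4%:R : CC R) * #|calC|%:R = 1.
  by rewrite card_calC divfK // (pnatr_eq0 R[i]).
have nablaE a : a \in calC -> nabla (e a) =
    - (\sum_(b : {b : A4 | b \in calC}) e (val b) \ox e ((val b)^-1 * a * val b)%g)
    + quarter *: (theta \ox theta).
  exact: (cov_deriv_shifted_mc k4 (@calC_conj_theta _)).
have RiemE a : a \in calC -> Riem (e a) =
    \sum_(b : {b : A4 | b \in calC}) d (e (val b)) \oxx
      e ((val b)^-1 * a * val b)%g.
  exact: (riemann_shifted_mc k4 (wedge_theta _ calC_MMV) calC_mul_notin).
(* Expanding over $b = t,x,y,z$ gives the terms in the stated order, so only the conjugates remain
   to be computed. *)
have nablaE4 a := big_calC (fun b => e b \ox e (b^-1 * a * b)%g).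
have RiemE4 a := big_calC (fun b => d (e b) \oxx e (b^-1 * a * b)%g).
split; split.
- by rewrite (nablaE _ tC) nablaE4 !opprD tt tx ty tz.
- by rewrite (nablaE _ xC) nablaE4 !opprD xt xx xy xz.
- by rewrite (nablaE _ yC) nablaE4 !opprD yt yx yy yz.
- by rewrite (nablaE _ zC) nablaE4 !opprD zt zx zy zz.
- by rewrite (RiemE _ tC) RiemE4 tt tx ty tz.
- by rewrite (RiemE _ xC) RiemE4 xt xx xy xz.
- by rewrite (RiemE _ yC) RiemE4 yt yx yy yz.
- by rewrite (RiemE _ zC) RiemE4 zt zx zy zz.
Qed.
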